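(* Let $p$ be a prime with $p\equiv 1\pmod 6$, and let $G=C_p\rtimes C_3$ be the semidirect product with respect to a nontrivial action of $C_3$ on $C_p$ (so $G$ is the nonabelian group of order $3p$). Then $$\mathcal{V}(G)=\frac{p+1}{p+3}.$$
   Context: For a finite group $G$, $L(G)$ denotes the set of all subgroups of $G$ (including the trivial subgroup and $G$ itself), $s(G)$ denotes the number of subgroups of $G$ that are simple groups (the trivial group is not simple; cyclic groups of prime order are simple), and $\mathcal{V}(G)=s(G)/|L(G)|$. Subgroups are counted as subsets of $G$. $C_m$ is the cyclic group of order $m$. *)

(* Defs.v *)
From HB Require Import structures.
From mathcomp Require Import all_boot all_order all_algebra all_fingroup all_solvable.

Set Implicit Arguments.
Unset Strict Implicit.
Unset Printing Implicit Defensive.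

Import GroupScope.

Definition nb_simple_subgroups (gT : finGroupType) (G : {group gT}) : nat :=
  #|[set H in subgroups G | simple H]|.

Definition simple_ratio (gT : finGroupType) (G : {group gT}) : rat :=
  ((nb_simple_subgroups G)%:R / #|subgroups G|%:R)%R.

(* Main.v *)
(* A subgroup either contains the kernel K of prime order or meets it trivially; since
   |G : K| = 3, the first kind is K or G and the second is 1 or a Sylow 3-subgroup.
   The number of Sylow 3-subgroups is the index of N_G(H) and divides |G : H| = p; it is
   not 1, as two normal subgroups with trivial intersection centralise each other.
   Hence |L(G)| = p + 3, and all subgroups except 1 and G have prime order. *)

Require Import Defs.
From HB Require Import structures.
From mathcomp Require Import all_boot all_order all_algebra all_fingroup all_solvable.

Set Implicit Arguments.
Unset Strict Implicit.
Unset Printing Implicit Defensive.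

Import GroupScope.

(** Mutual normalisation puts the commutator of [K] and [H] inside [K :&: H], hence makes it
    trivial. *)
Lemma norm_TI_centralised (gT : finGroupType) (K H : {group gT}) :
  H \subset 'N(K) -> K \subset 'N(H) -> K :&: H = 1 -> H \subset 'C(K).
Proof.
move=> nKH nHK tiKH; rewrite centsC; apply/commG1P/trivgP.
by rewrite -tiKH commg_subI // subsetI subxx.
Qed.

Lemma simple_prime (gT : finGroupType) (A : {group gT}) : prime #|A| -> simple A.
Proof.
move=> prA; apply/simpleP; split=> [|B /normal_sub sBA].
  by rewrite trivg_card1 gtn_eqF ?prime_gt1.
have [sAB | /(prime_TIg prA) tiAB] := boolP (A \subset B).
  by right; apply/eqP; rewrite eqEsubset sBA.
by left; rewrite -tiAB (setIidPr sBA).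
Qed.

Section PrimeBySemidirectPrime.

Variables (p q : nat) (gT : finGroupType) (G K H : {group gT}).
Hypotheses (p_prime : prime p) (q_prime : prime q) (neq_pq : p != q).
Hypotheses (oK : #|K| = p) (oH : #|H| = q) (defG : K ><| H = G).

Let oG : #|G| = (p * q)%N.
Proof. by rewrite -(sdprod_card defG) oK oH. Qed.

Let nsKG : K <| G.
Proof. by case/sdprod_context: defG. Qed.

Let sHG : H \subset G.
Proof. by case/sdprod_context: defG. Qed.

(** Since [p != q], the [q]-part of [#|G| = p * q] is exactly [q]. *)
Lemma Sylow_card_prime (L : {group gT}) :
  q.-Sylow(G) L = (L \subset G) && (#|L| == q).
Proof.
rewrite pHallE oG p_part lognM ?prime_gt0 // (logn_prime _ p_prime).
by rewrite (logn_prime _ q_prime) eqxx [q == p]eq_sym (negPf neq_pq) add0n expn1.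
Qed.

Lemma subgroups_prime_sdprod :
  subgroups G = [set 1%G; G] :|: (K |: 'Syl_q(G)).
Proof.
apply/setP=> L; rewrite !inE Sylow_card_prime.
have sKG := normal_sub nsKG.
apply/idP/idP=> [sLG | ]; last first.
  by case/orP=> [/orP[] | /orP[|/andP[//]]] /eqP->; rewrite ?sub1G.
have [tiKL | sKL] : K :&: L = 1 \/ K \subset L.
- by case: (boolP (K \subset L)) => [|nsKL]; [right | left; apply: prime_TIg; rewrite ?oK].
- have nKL : L \subset 'N(K) := subset_trans sLG (normal_norm nsKG).
  (* With trivial intersection, [K <*> L] has order [p * #|L|], which divides [p * q]; so [#|L|] is
     1 or [q]. *)
  have: #|K <*> L| %| #|G| by rewrite cardSg // join_subG sKG.
  rewrite norm_joinEr // TI_cardMg // oG oK dvdn_pmul2l ?prime_gt0 //.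
  case/primeP: q_prime => _ dvq /dvq /orP[oL | ->]; last by rewrite sLG !orbT.
  by rewrite -trivg_card1 in oL; move/eqP: oL => oL; rewrite -val_eqE /= oL eqxx.
(* Here [#|L : K|] divides [q]: index 1 gives [K], index [q] gives [G]. *)
have := cardSg sLG; rewrite -(Lagrange sKL) oG oK dvdn_pmul2l ?prime_gt0 //.
case/primeP: q_prime => _ dvq /dvq /orP[/eqP iKL | /eqP iKL].
  have -> : L = K by apply/eqP; rewrite eq_sym -val_eqE /= eqEsubset sKL -indexg_eq1 iKL.
  by rewrite eqxx !orbT.
have -> : L = G.
  by apply/eqP; rewrite -val_eqE /= eqEcard sLG oG -(Lagrange sKL) oK iKL /=.
by rewrite eqxx orbT.
Qed.

Lemma card_Syl_prime_sdprod : ~~ (H \subset 'C(K)) -> #|'Syl_q(G)| = p.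
Proof.
move=> ncHK.
have sylH : q.-Sylow(G) H by rewrite Sylow_card_prime sHG oH eqxx.
have iHG : #|G : H| = p by rewrite -divgS // oG oH mulnK ?prime_gt0.
have: #|'Syl_q(G)| %| p.
  by rewrite (card_Syl sylH) -iHG indexgS // subsetI sHG normG.
case/primeP: p_prime => _ dvp /dvp /orP[|/eqP //].
(* A single Sylow subgroup would make [H] normal in [G], so [H] would centralise [K]. *)
rewrite (card_Syl sylH) indexg_eq1 subsetI subxx /= => nHG.
case/negP: ncHK; case/sdprod_context: defG => _ _ _ nKH tiKH.
exact: norm_TI_centralised (subset_trans (normal_sub nsKG) nHG) tiKH.
Qed.

Let card_kernel_Syl : ~~ (H \subset 'C(K)) -> #|K |: 'Syl_q(G)| = p.+1.
Proof.
move=> ncHK.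
by rewrite cardsU1 inE Sylow_card_prime oK (negPf neq_pq) andbF card_Syl_prime_sdprod.
Qed.

(** The total is 1 + 1 + ([p] + 1), from [1], [G], and [K] with the [p] Sylow subgroups; it does not
    depend on [q]. *)
Lemma card_subgroups_prime_sdprod :
  ~~ (H \subset 'C(K)) -> #|subgroups G| = (p + 3)%N.
Proof.
move=> ncHK; have [p1 q1] := (prime_gt1 p_prime, prime_gt1 q_prime).
(* Orders alone separate [1] and [G] from the subgroups of order [p] or [q], so the union is
   disjoint. *)
have neqL (L : {group gT}) : #|L| != p -> #|L| != q -> L \notin K |: 'Syl_q(G).
  move=> neLp neLq; rewrite !inE Sylow_card_prime (negPf neLq) andbF orbF.
  by apply: contraNneq neLp => ->; rewrite oK.
have neq1G : (1%G == G) = false.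
  apply/eqP=> /(congr1 (fun L : {group gT} => #|L|)); rewrite oG cards1 => /esym/eqP.
  by rewrite muln_eq1 gtn_eqF.
have neqGp : #|G| != p.
  by rewrite oG -[X in _ != X]muln1 eqn_pmul2l ?prime_gt0 // gtn_eqF.
have neqGq : #|G| != q.
  by rewrite oG -[X in _ != X]mul1n eqn_pmul2r ?prime_gt0 // gtn_eqF.
rewrite subgroups_prime_sdprod -setUA cardsU1 cardsU1 card_kernel_Syl //.
have notin1 := neqL 1%G; rewrite cards1 !ltn_eqF // in notin1.
by rewrite in_setU1 neq1G (negPf (notin1 _ _)) // neqL // addn3.
Qed.

Lemma nb_simple_subgroups_prime_sdprod :
  ~~ (H \subset 'C(K)) -> nb_simple_subgroups G = (p + 1)%N.
Proof.
move=> ncHK; rewrite addn1 -(card_kernel_Syl ncHK); apply: eq_card => L.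
rewrite inE subgroups_prime_sdprod in_setU andb_orl.
(* [G] is not simple because [K] is a normal subgroup with 1 < [p] < [p * q]. *)
have -> : (L \in [set 1%G; G]) && simple L = false.
  apply/negP=> /andP[]; rewrite !inE => /orP[] /eqP-> /simpleP[ntL simL].
    by rewrite eqxx in ntL.
  have [p1 q1] := (prime_gt1 p_prime, prime_gt1 q_prime).
  case: (simL K nsKG) => [K1 | KG]; first by rewrite -oK K1 cards1 in p1.
  move/eqP: oG; rewrite -KG oK -[X in X == _]muln1 eqn_pmul2l ?prime_gt0 //.
  by rewrite ltn_eqF.
(* The remaining subgroups have prime order, so the simplicity filter discards none of them. *)
rewrite orFb andb_idr // !inE Sylow_card_prime.
by case/orP=> [/eqP-> | /andP[_ /eqP oL]]; apply: simple_prime; rewrite ?oK ?oL.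
Qed.

End PrimeBySemidirectPrime.

Theorem proposition2p20 (p : nat) (gT : finGroupType) (G K H : {group gT})
    (p_prime : prime p) (p_mod6 : p = 1 %[mod 6])
    (cycK : cyclic K) (oK : #|K| = p)
    (cycH : cyclic H) (oH : #|H| = 3)
    (defG : K ><| H = G)
    (nontrivial_action : ~~ (H \subset 'C(K))) :
  simple_ratio G = ((p%:R + 1) / (p%:R + 3))%R.
Proof.
(* The congruence rules out [p = 3], which makes the two primes distinct. *)
have neqp3 : p != 3 by apply: contra_eqN p_mod6 => /eqP->.
by rewrite /simple_ratio (nb_simple_subgroups_prime_sdprod p_prime _ neqp3 oK oH defG) //
  (card_subgroups_prime_sdprod p_prime _ neqp3 oK oH defG) // !GRing.natrD.
Qed.
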